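(* Let $D\equiv 1\pmod 4$ be a square-free positive integer of the form $D=s^2+4$ with $s$ an integer, let $F=\mathbb{Q}(\sqrt D)$, $B=\left(\frac{-1,-1}{F}\right)$, and let $\mathcal{O}$ be the $\mathbb{Z}_F$-module generated by $1,\ i,\ \frac{\sqrt D+1}{4}+\frac{\sqrt D+3}{4}i+\frac{j}{2},\ \frac{\sqrt D+3}{4}+\frac{\sqrt D+1}{4}i+\frac{k}{2}$ (a maximal order of $B$). Let $\varepsilon=\frac{s+\sqrt D}{2}$ and $\alpha=\frac{\varepsilon}{\sqrt D}$. Then the lattice $\Lambda_{(\mathcal{O},\alpha)}$ is similar to the lattice $E_8$.
   Context: $B=\left(\frac{-1,-1}{F}\right)$ has $F$-basis $1,i,j,k$ with $i^2=j^2=-1$, $ij=-ji=k$; $\mathbb{Z}_F=\mathbb{Z}[\frac{1+\sqrt D}{2}]$. Let $\sigma_1,\sigma_2$ be the real embeddings of $F$. For a totally positive $\alpha\in F$, $\sigma_{B,\alpha}:B\to\mathbb{R}^{8}$ sends $x+yi+zj+tk$ ($x,y,z,t\in F$) to $(\sqrt{2\sigma_1(\alpha)}\sigma_1(x),\sqrt{2\sigma_2(\alpha)}\sigma_2(x),\dots,\sqrt{2\sigma_1(\alpha)}\sigma_1(t),\sqrt{2\sigma_2(\alpha)}\sigma_2(t))$, and $\Lambda_{(\mathcal{O},\alpha)}=\sigma_{B,\alpha}(\mathcal{O})$. Two lattices are similar if one is the image of the other under an isometry composed with a scaling. $E_8$ is the unique (up to isometry) even unimodular lattice in dimension 8. 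*)

(* Defs.v *)
From HB Require Import structures.
From mathcomp Require Import all_boot all_order all_algebra all_field.
From mathcomp Require Import classical_sets reals.
From mathcomp Require Import ring lra.

Set Implicit Arguments.
Unset Strict Implicit.
Unset Printing Implicit Defensive.

Import Order.TTheory GRing.Theory Num.Theory.
Local Open Scope classical_set_scope.
Local Open Scope ring_scope.

Definition square_free (n : nat) : Prop :=
  forall d : nat, (d ^ 2 %| n)%N -> d = 1%N.

Section Quaternions.
Variables (F : fieldExtType rat) (B : falgType F).

(* [quaternion_basis a b i j k]: B is the quaternion algebra (a, b / F), with
   standard basis 1, i, j, k. *)
Definition quaternion_basis (a b : F) (i j k : B) : Prop :=
  [/\ basis_of fullv [tuple 1; i; j; k],
      i * i = a%:A, j * j = b%:A, i * j = k & j * i = - k].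

(* Z[w] *)
Definition Zadjoin (w : F) : set F :=
  [set x | exists p : {poly int}, x = (map_poly intr p).[w]].

Definition generated_module (A : set F) (n : nat) (g : n.-tuple B) : set B :=
  [set x | exists2 c : 'I_n -> F,
     (forall m, A (c m)) & x = \sum_m c m *: tnth g m].

(* The coordinates are interleaved: entries 2l and 2l+1 are the images under
   sigma1 and sigma2 of the l-th coordinate in the basis 1, i, j, k. *)
Definition quaternion_embedding (R : realType)
    (sigma1 sigma2 : {rmorphism F -> R}) (i j k : B) (alpha : F) (v : B) :
    'rV[R]_8 :=
  \row_(m < 8)
    let sigma := if odd m then sigma2 else sigma1 in
    Num.sqrt (2 * sigma alpha) *
    sigma (coord [tuple 1; i; j; k] (inord m./2) v).

Definition quaternion_lattice (R : realType)
    (sigma1 sigma2 : {rmorphism F -> R}) (i j k : B) (O : set B) (alpha : F) :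
    set 'rV[R]_8 :=
  quaternion_embedding sigma1 sigma2 i j k alpha @` O.

End Quaternions.

Section Lattices.
Variables (R : realType) (n : nat).
Implicit Types (u v x y : 'rV[R]_n) (L M : set 'rV[R]_n).

Definition dot u v : R := \sum_m u 0 m * v 0 m.

Definition similar_lattices L M : Prop :=
  exists (f : {linear 'rV[R]_n -> 'rV[R]_n}) (c : R),
    [/\ forall u v, dot (f u) (f v) = dot u v,
        0 < c & M = (fun x => c *: f x) @` L].

End Lattices.

Definition E8 (R : realType) : set 'rV[R]_8 :=
  [set x | ((forall m, x 0 m \is a Num.int) \/
            (forall m, x 0 m - 2^-1 \is a Num.int)) /\
           (\sum_m x 0 m) / 2 \is a Num.int].

(* The next two lemmas check that E8 is an even unimodular lattice (integral,
   and equal to its dual) in dimension 8. *)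
Section E8Facts.
Variable R : realType.
Implicit Types x y : 'rV[R]_8.

Lemma half_sqrB_int (a : R) : a \is a Num.int -> (a ^+ 2 - a) / 2 \is a Num.int.
Proof.
move=> /intrP[m ->]; apply/intrP.
exists ((m ^+ 2 - m) %/ 2)%Z.
have h : (2 %| m ^+ 2 - m)%Z.
  rewrite (divz_eq m 2); set q := (m %/ 2)%Z.
  have : (m %% 2)%Z = 0 \/ (m %% 2)%Z = 1.
    have h0 := modz_ge0 m (isT : (2 : int) != 0).
    have h1 := ltz_pmod m (isT : (0 : int) < 2).
    move: h0 h1; case: (m %% 2)%Z => [[|[|]]|] //; by [left|right].
  case=> ->.
    by apply/dvdzP; exists (2 * q ^+ 2 - q); ring.
  by apply/dvdzP; exists (2 * q ^+ 2 + q); ring.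
apply: (mulIf (_ : (2 : R) != 0)); first by rewrite pnatr_eq0.
rewrite divfK ?pnatr_eq0 //.
have -> : (2 : R) = (2%:Z)%:~R by [].
by rewrite -intrM divzK // intrB rmorphXn.
Qed.

Lemma E8_even x : E8 x -> dot x x / 2 \is a Num.int.
Proof.
case=> -[hx|hx] hs.
  have -> : dot x x / 2 =
      \sum_m ((x 0 m) ^+ 2 - x 0 m) / 2 + (\sum_m x 0 m) / 2.
    rewrite /dot !mulr_suml -big_split /=.
    by apply: eq_bigr => m _; field.
  by apply: rpredD => //; apply: rpred_sum => m _; apply: half_sqrB_int.
have -> : dot x x / 2 =
    \sum_m (((x 0 m - 2^-1) ^+ 2 - (x 0 m - 2^-1)) / 2 + (x 0 m - 2^-1)) + 1.
  rewrite /dot !mulr_suml.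
  have one_sum : (1 : R) = \sum_(m < 8) 8^-1.
    by rewrite sumr_const card_ord -mulr_natr; field.
  rewrite [X in _ + X]one_sum -big_split /=.
  by apply: eq_bigr => m _; field.
apply: rpredD; last exact: rpred1.
apply: rpred_sum => m _.
by apply: rpredD => //; apply: half_sqrB_int.
Qed.

Lemma E8_add x y : E8 x -> E8 y -> E8 (x + y).
Proof.
move=> [hx sx] [hy sy]; split; last first.
  have -> : \sum_m (x + y) 0 m = \sum_m x 0 m + \sum_m y 0 m.
    by rewrite -big_split /=; apply: eq_bigr => m _; rewrite mxE.
  by rewrite mulrDl rpredD.
case: hx hy => hx [] hy; [left|right|right|left] => m; rewrite mxE.
- exact: rpredD.
- by rewrite -addrA rpredD.
- by rewrite addrAC rpredD.
- have -> : x 0 m + y 0 m = (x 0 m - 2^-1) + (y 0 m - 2^-1) + 1 by field.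
  by apply: rpredD; [apply: rpredD | exact: rpred1].
Qed.

Lemma E8_unimodular y :
  E8 y <-> (forall x, E8 x -> dot x y \is a Num.int).
Proof.
split=> [hy x hx|h].
  have -> : dot x y = dot (x + y) (x + y) / 2 - dot x x / 2 - dot y y / 2.
    rewrite /dot !mulr_suml -!sumrB; apply: eq_bigr => m _.
    by rewrite !mxE; field.
  by rewrite !rpredB //; apply: E8_even => //; apply: E8_add.
have sdelta m : \sum_l (delta_mx 0 m : 'rV[R]_8) 0 l = 1.
  rewrite (bigD1 m) //= big1 ?mxE ?eqxx ?addr0 // => l /negPf hl.
  by rewrite mxE eqxx hl.
have ddelta m : dot (delta_mx 0 m) y = y 0 m.
  rewrite /dot (bigD1 m) //= big1 ?mxE ?eqxx ?addr0 ?mul1r // => l /negPf hl.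
  by rewrite mxE eqxx hl mul0r.
have idelta m l : (delta_mx 0 m : 'rV[R]_8) 0 l \is a Num.int.
  by rewrite mxE; case: (_ && _).
have dotD u v : dot (u + v) y = dot u y + dot v y.
  by rewrite /dot -big_split; apply: eq_bigr => l _; rewrite mxE mulrDl.
have hD m l : y 0 m + y 0 l \is a Num.int.
  rewrite -(ddelta m) -(ddelta l) -dotD; apply: h; split.
    by left=> r; rewrite mxE rpredD.
  have -> : \sum_r (delta_mx 0 m + delta_mx 0 l : 'rV[R]_8) 0 r = 2.
    under eq_bigr do rewrite mxE.
    by rewrite big_split /= !sdelta.
  by rewrite divff ?pnatr_eq0.
have hhalf : (\sum_m y 0 m) / 2 \is a Num.int.
  have := h (const_mx 2^-1); rewrite /dot.
  under eq_bigr do rewrite mxE mulrC.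
  rewrite -mulr_suml; apply; split.
    by right=> r; rewrite mxE subrr.
  under eq_bigr do rewrite mxE.
  rewrite sumr_const card_ord.
  by have -> : (2^-1 : R) *+ 8 / 2 = 2 by rewrite -mulr_natr; field.
split=> //.
have /intrP[q hq] := hD 0 0.
have hB m : y 0 m - y 0 0 \is a Num.int.
  have -> : y 0 m - y 0 0 = (y 0 m + y 0 0) - (y 0 0 + y 0 0) by ring.
  by rewrite rpredB.
have hq' : y 0 0 = q%:~R / 2 by rewrite -hq; field.
have : (q %% 2)%Z = 0 \/ (q %% 2)%Z = 1.
  have h0 := modz_ge0 q (isT : (2 : int) != 0).
  have h1 := ltz_pmod q (isT : (0 : int) < 2).
  by move: h0 h1; case: (q %% 2)%Z => [[|[|]]|] //; [left|right].
move=> hmod; move: hq'; rewrite (divz_eq q 2) intrD intrM => hq'.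
case: hmod hq' => -> hq'; [left|right] => m.
  have -> : y 0 m = (y 0 m - y 0 0) + (q %/ 2)%Z%:~R.
    by rewrite hq'; field.
  by rewrite rpredD // intr_int.
have -> : y 0 m - 2^-1 = (y 0 m - y 0 0) + (q %/ 2)%Z%:~R.
  by rewrite hq'; field.
by rewrite rpredD // intr_int.
Qed.

End E8Facts.

(* Main.v *)
(** The unit [v = (sqrt D - s) / 2] has norm [-1], and [1, v] is an orthonormal
    basis of Z_F for the form Tr(alpha x y): this is where D = s^2 + 4 enters.
    In this basis the order O, which lies between Z_F^4 and (Z_F^4) / 2, is the
    Construction A lattice of an [8, 4, 4] Hamming code: since D = 5 mod 8,
    Z_F / 2 is the field with four elements, and the code depends only on
    s mod 4, through an exchange of the coordinates at 1 and i.  Pairing the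
    eight coordinates so that each codeword of weight 4 is either a union of two
    pairs or meets every pair once, and replacing each pair (x, y) by
    (x + y, x - y), gives exactly the standard coordinates of E8. *)

Require Import Defs.
From HB Require Import structures.
From mathcomp Require Import all_boot all_order all_algebra all_field.
From mathcomp Require Import boolp classical_sets reals.
From mathcomp Require Import zify ring.

Set Implicit Arguments.
Unset Strict Implicit.
Unset Printing Implicit Defensive.

Import Order.TTheory GRing.Theory Num.Theory.
Local Open Scope ring_scope.

(** * Arithmetic of Z[w] and of s, and embeddings of F *)

(** Each Horner step stays in Z + Z w, because w^2 does. *)
Lemma Zadjoin_quadratic (F : fieldExtType rat) (w x : F) (a b : int) :
  w ^+ 2 = a%:~R + b%:~R * w ->
  Zadjoin w x <-> exists p q : int, x = p%:~R + q%:~R * w.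
Proof.
move=> hw; split=> [[p ->]|[p [q ->]]].
  elim/poly_ind: p => [|p c [m [n IH]]].
    by exists 0, 0; rewrite rmorph0 horner0; ring.
  exists (c + n * a), (m + n * b).
  rewrite rmorphD rmorphM /= map_polyX map_polyC /= hornerMXaddC IH.
  rewrite mulrDl -mulrA -expr2 hw !rmorphD !rmorphM /=; ring.
exists (p%:P + q%:P * 'X).
by rewrite rmorphD rmorphM /= map_polyX !map_polyC /= !hornerE.
Qed.

Lemma int_parity (m : int) : exists k : int, m = 2 * k \/ m = 2 * k + 1.
Proof.
exists (m %/ 2)%Z; have h0 := modz_ge0 m (isT : (2 : int) != 0).
have h1 := ltz_pmod m (isT : (0 : int) < 2).
rewrite [(2 * _)%R]mulrC {1 3}(divz_eq m 2).
by move: h0 h1; case: (m %% 2)%Z => [[|[|]]|] // _ _; [left; ring|right].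
Qed.

(** An even s would make D divisible by 4. *)
Lemma odd_of_sqrD4 (D : nat) (s : int) :
  D = 1 %[mod 4] -> D%:Z = s ^+ 2 + 4 -> exists h : int, s = 2 * h - 1.
Proof.
move=> hD4 hDs; have [k [e|e]] := int_parity s; last first.
  by exists (k + 1); rewrite e; ring.
have : (D%:Z = 1%N%:Z %[mod 4%N])%Z by rewrite !modz_nat hD4.
by rewrite hDs e exprMn modzDr modzMr.
Qed.

(** Every element is a polynomial in x over the rationals, which embeddings fix. *)
Lemma rmorph_Fadjoin_inj (F : fieldExtType rat) (R : numFieldType) (x : F)
    (f g : {rmorphism F -> R}) :
  <<1; x>>%VS = {:F}%VS -> f x = g x -> f =1 g.
Proof.
move=> hF hx y.
have /Fadjoin_poly_eq <- : y \in <<1; x>>%VS by rewrite hF memvf.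
rewrite -!horner_map /= hx; congr (_.[_]); apply/polyP => n; rewrite !coef_map /=.
have /polyOverP/(_ n)/vlineP[c ->] := Fadjoin_polyOver 1 x y.
have rat_fixed (e : {rmorphism F -> R}) : e c%:A = ratr c.
  exact: (fmorph_eq_rat (e \o in_alg F)).
by rewrite !rat_fixed.
Qed.

(** * Row vectors of length 8, and E8 in coordinates adapted to the order *)

Section Row8.
Variable R : realType.
Implicit Types (u v : 'rV[R]_8) (s : seq R).

Definition row8 s : 'rV[R]_8 := \row_(m < 8) s`_m.

Lemma row8E s n : (n < 8)%N -> row8 s 0 (inord n) = s`_n.
Proof. by move=> hn; rewrite mxE inordK. Qed.

Lemma row8_eq u v :
  (forall n, (n < 8)%N -> u 0 (inord n) = v 0 (inord n)) -> u = v.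
Proof. by move=> h; apply/rowP => m; have := h m; rewrite inord_val; apply. Qed.

Lemma sum8E (A : nmodType) (G : 'I_8 -> A) :
  \sum_m G m = G (inord 0) + G (inord 1) + G (inord 2) + G (inord 3) +
               G (inord 4) + G (inord 5) + G (inord 6) + G (inord 7).
Proof.
have -> : \sum_m G m = \sum_(0 <= m < 8) G (inord m).
  by rewrite big_mkord; apply: eq_bigr => m _; rewrite inord_val.
by rewrite !big_nat_recr //= big_geq // add0r.
Qed.

End Row8.

(* [(A0, B0), (A1, B1), (p2, q2), (p3, q3)] are twice the coordinates, in the
   basis [1, v] of Z_F, of the four components of an element of O, up to the
   exchange of the first two: compare [order_coordP]. *)
Lemma E8P (R : realType) (h : int) (z : 'rV[R]_8) :
  let s := 2 * h - 1 in
  E8 z <-> exists d0 e0 d1 e1 p2 q2 p3 q3 : int,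
    let A0 := 2 * d0 + q2 + q3 + p3 in
    let B0 := 2 * e0 + p2 - s * q2 + p3 + (1 - s) * q3 in
    let A1 := 2 * d1 + q2 + p2 + q3 in
    let B1 := 2 * e1 + p2 + (1 - s) * q2 + p3 - s * q3 in
    z = row8 [seq n%:~R / 2 | n <- [:: p2 + p3; p2 - p3; A1 + A0; A1 - A0;
                                      B0 + q2; B0 - q2; B1 + q3; B1 - q3]].
Proof.
move=> s; split.
- move=> [hz /intrP[N hN]].
  have [e hez] : exists e : int, forall m, z 0 m - e%:~R / 2 \is a Num.int.
    by case: hz => hz; [exists 0 | exists 1] => m; have := hz m;
      rewrite ?mul0r ?subr0 ?mul1r.
  have {hz} /fin_all_exists[n hn] : forall m, exists n : int, z 0 m = n%:~R + e%:~R / 2.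
    by move=> m; have /intrP[n hn] := hez m; exists n; rewrite -hn subrK.
  pose n' l := n (inord l).
  have hN' : n' 0%N + n' 1%N + n' 2%N + n' 3%N + n' 4%N + n' 5%N + n' 6%N
    + n' 7%N = 2 * N - 4 * e.
    apply: (@intr_inj R); rewrite !(intrD, intrB, intrM) -hN sum8E !hn /n'.
    by field.
  (* Half-sums and half-differences of paired entries give all unknowns. The divisions by 2 are
     exact by [hN'] for [d0], [d1], and because s is odd for [e0], [e1]. *)
  exists (N - 2 * e - (n' 0%N + n' 3%N + n' 4%N + n' 6%N)),
    (n' 5%N - n' 0%N + h * (n' 4%N - n' 5%N) - (1 - h) * (n' 6%N - n' 7%N)),
    (N - 2 * e - (n' 0%N + n' 1%N + n' 4%N + n' 6%N)),
    (n' 7%N - n' 0%N - (1 - h) * (n' 4%N - n' 5%N) + h * (n' 6%N - n' 7%N)),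
    (n' 0%N + n' 1%N + e), (n' 4%N - n' 5%N),
    (n' 0%N - n' 1%N), (n' 6%N - n' 7%N) => /=.
  have e2 k l : (2 * k + e = l) -> k%:~R + e%:~R / 2 = l%:~R / 2 :> R.
    by move=> <-; rewrite intrD intrM; field.
  apply: row8_eq => l hl; rewrite row8E // hn -/(n' l).
  by do 8![case: l hl => [_|l hl] /=; first (apply: e2; rewrite /s; lia)].
- move=> [d0 [e0 [d1 [e1 [p2 [q2 [p3 [q3]]]]]]]] /= hz; split; last first.
    rewrite hz sum8E !row8E //=; apply/intrP.
    exists (d1 + e0 + e1 + 2 * p2 + p3 + (1 - s) * (q2 + q3)).
    by rewrite /s !(intrD, intrB, intrM); field.
  (* All entries agree with (p2 + p3) / 2 modulo 1, so this parity separates integral from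
     half-integral vectors. *)
  have [k hk] := int_parity (p2 + p3).
  have hp : forall l, (l < 8)%N -> exists n : int,
      z 0 (inord l) = n%:~R + (p2 + p3)%:~R / 2.
    move=> l hl; exists (nth 0 [:: 0; - p3; d1 + d0 + q2 + q3; d1 - d0 - p3;
      e0 + (1 - h) * (q2 + q3); e0 + (1 - h) * (q2 + q3) - q2;
      e1 + (1 - h) * (q2 + q3); e1 + (1 - h) * (q2 + q3) - q3] l).
    rewrite hz row8E //.
    by do 8![case: l hl => [_|l hl] /=;
      first by rewrite /s !(intrD, intrB, intrM, intrN); field].
  case: hk => hk; [left|right] => m; have [n] := hp m (ltn_ord m);
    rewrite inord_val hk => ->.
    have -> : n%:~R + (2 * k)%:~R / 2 = (n + k)%:~R :> R.
      by rewrite intrM intrD; field.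
    exact: intr_int.
  have -> : n%:~R + (2 * k + 1)%:~R / 2 - 2^-1 = (n + k)%:~R :> R.
    by rewrite !(intrM, intrD); field.
  exact: intr_int.
Qed.

(** * The isometry of R^8 given by the orthonormal basis [1, v] *)

Section BlockIsometry.
Variables (R : realType) (m n v1 v2 : R) (t : bool).
Hypothesis hm : 2 * m ^+ 2 * (1 + v1 ^+ 2) = 1.
Hypothesis hn : 2 * n ^+ 2 * (1 + v2 ^+ 2) = 1.
Hypothesis hv : v1 * v2 = -1.
Implicit Types u v : 'rV[R]_8.

(** With m, n the halves of sqrt(2 sigma(alpha)) and v1, v2 the conjugates of v, these are half the
    inner products of block l with the images of 1 and v. *)
Definition pair_fst u (l : nat) := m * u 0 (inord l.*2) + n * u 0 (inord l.*2.+1).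
Definition pair_snd u (l : nat) :=
  m * v1 * u 0 (inord l.*2) + n * v2 * u 0 (inord l.*2.+1).

(* [pair_fst] and [pair_snd] recover [a] and [b] from the two real embeddings of
   [a + b v]; [t] exchanges the components at 1 and i. *)
Definition block_map u : 'rV[R]_8 :=
  let a := pair_fst u in let b := pair_snd u in
  let i0 : nat := t in let i1 : nat := ~~ t in
  row8 [:: a 2%N + a 3%N; a 2%N - a 3%N; a i1 + a i0; a i1 - a i0;
           b i0 + b 2%N; b i0 - b 2%N; b i1 + b 3%N; b i1 - b 3%N].

Lemma block_map_linear : linear block_map.
Proof.
move=> c u v; apply: row8_eq => l hl.
rewrite [RHS]mxE [X in _ = X + _]mxE !row8E // /pair_fst /pair_snd !mxE.
by do 8![case: l hl => [_|l hl] /=; first ring].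
Qed.

HB.instance Definition _ :=
  GRing.isLinear.Build R 'rV[R]_8 'rV[R]_8 _ block_map block_map_linear.

(** Up to the factor sqrt 2, the matrix with rows (m, n) and (m v1, n v2) has orthonormal columns,
    by [hm], [hn] and [hv]. *)
Lemma dot_pairs u v l :
  2 * (pair_fst u l * pair_fst v l + pair_snd u l * pair_snd v l) =
  u 0 (inord l.*2) * v 0 (inord l.*2)
  + u 0 (inord l.*2.+1) * v 0 (inord l.*2.+1).
Proof.
rewrite /pair_fst /pair_snd.
set x := u 0 _; set y := u 0 _; set x' := v 0 _; set y' := v 0 _.
transitivity ((2 * m ^+ 2 * (1 + v1 ^+ 2)) * (x * x')
  + (2 * n ^+ 2 * (1 + v2 ^+ 2)) * (y * y')
  + 2 * (1 + v1 * v2) * (m * n * (x * y' + y * x'))); first by ring.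
by rewrite hm hn hv; ring.
Qed.

(** Each map (x, y) to (x + y, x - y) doubles inner products, which supplies the factor 2 of
    [dot_pairs]. *)
Lemma block_map_isometry u v : dot (block_map u) (block_map v) = dot u v.
Proof.
have e l := esym (dot_pairs u v l).
rewrite /dot !sum8E !row8E //=.
have := (e 0%N, e 1%N, e 2%N, e 3%N); rewrite /= => -[[[e0 e1] e2] e3].
rewrite [RHS](ACl ((1*2)*(3*4)*(5*6)*(7*8))) /= e0 e1 e2 e3.
by case: t => /=; ring.
Qed.

(** The rows of the same matrix are orthonormal too: [e1], [e2], [e3] are their inner products. *)
Lemma pair_coord u l a b :
  u 0 (inord l.*2) = m * (a + b * v1) -> u 0 (inord l.*2.+1) = n * (a + b * v2) ->
  pair_fst u l = a / 2 /\ pair_snd u l = b / 2.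
Proof.
have nz : 1 + v1 ^+ 2 != 0.
  by rewrite lt0r_neq0 // (lt_le_trans ltr01) // lerDl sqr_ge0.
have hn' : 2 * n ^+ 2 * (1 + v1 ^+ 2) = v1 ^+ 2.
  transitivity (2 * n ^+ 2 * (1 + v2 ^+ 2) * v1 ^+ 2); last by rewrite hn mul1r.
  by ring: hv.
have e1 : 2 * (m ^+ 2 + n ^+ 2) = 1.
  apply: (mulIf nz); rewrite mul1r.
  transitivity (2 * m ^+ 2 * (1 + v1 ^+ 2) + 2 * n ^+ 2 * (1 + v1 ^+ 2)).
    by ring.
  by rewrite hm hn'.
have e2 : 2 * (m ^+ 2 * v1 + n ^+ 2 * v2) = 0.
  apply: (mulIf nz); transitivity ((2 * m ^+ 2 * (1 + v1 ^+ 2)) * v1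
    + (2 * n ^+ 2 * (1 + v1 ^+ 2)) * v2); first by ring.
  rewrite hm hn' mul0r; transitivity (v1 * (1 + v1 * v2)); first by ring.
  by rewrite hv subrr mulr0.
have e3 : 2 * (m ^+ 2 * v1 ^+ 2 + n ^+ 2 * v2 ^+ 2) = 1.
  transitivity (2 * m ^+ 2 * (1 + v1 ^+ 2) + 2 * n ^+ 2 * (1 + v2 ^+ 2)
    - 2 * (m ^+ 2 + n ^+ 2)); first by ring.
  by rewrite hm hn e1; ring.
rewrite /pair_fst /pair_snd => -> ->; split.
  transitivity (a * (2 * (m ^+ 2 + n ^+ 2)) / 2
    + b * (2 * (m ^+ 2 * v1 + n ^+ 2 * v2)) / 2); first by field.
  by rewrite e1 e2; ring.
transitivity (a * (2 * (m ^+ 2 * v1 + n ^+ 2 * v2)) / 2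
  + b * (2 * (m ^+ 2 * v1 ^+ 2 + n ^+ 2 * v2 ^+ 2)) / 2); first by field.
by rewrite e2 e3; ring.
Qed.

End BlockIsometry.

(** * The order in coordinates over the basis [1, v] *)

Lemma generated_module4 (F : fieldExtType rat) (B : falgType F) (A : set F)
    (g0 g1 g2 g3 x : B) :
  generated_module A [tuple g0; g1; g2; g3] x <->
  exists c0 c1 c2 c3, [/\ A c0, A c1, A c2 & A c3] /\
    x = c0 *: g0 + c1 *: g1 + c2 *: g2 + c3 *: g3.
Proof.
split=> [[c hc ->]|[c0 [c1 [c2 [c3 [[h0 h1 h2 h3] ->]]]]]].
  exists (c (inord 0)), (c (inord 1)), (c (inord 2)), (c (inord 3)).
  split; first by split; apply: hc.
  rewrite !big_ord_recr big_ord0 /= add0r.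
  by do !congr (_ + _); congr (c _ *: _); apply: val_inj; rewrite /= inordK.
exists (fun m => [:: c0; c1; c2; c3]`_m).
  by case=> [[|[|[|[|]]]]].
by rewrite !big_ord_recr big_ord0 /= add0r.
Qed.

Lemma collect_coord (F : fieldType) (V : lmodType F) (e0 e1 e2 e3 : V)
    (c0 c1 c2 c3 a b a' b' d : F) :
  c0 *: e0 + c1 *: e1 + c2 *: (a *: e0 + b *: e1 + d *: e2)
    + c3 *: (a' *: e0 + b' *: e1 + d *: e3) =
  (c0 + c2 * a + c3 * a') *: e0 + (c1 + c2 * b + c3 * b') *: e1
    + (c2 * d) *: e2 + (c3 * d) *: e3.
Proof.
rewrite !scalerDr !scalerDl !scalerA !addrA.
by rewrite [LHS](ACl (1*3*6*2*4*7*5*8)).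
Qed.

Lemma natr_eq0_fieldExt (F : fieldExtType rat) n : (n%:R == 0 :> F) = (n == 0)%N.
Proof. by rewrite -(rmorph_nat (in_alg F)) fmorph_eq0 pnatr_eq0. Qed.

Section OrderCoordinates.
Variables (F : fieldExtType rat) (B : falgType F) (e0 e1 e2 e3 : B).
Variables (sqrtD : F) (h k : int) (t : bool).
Hypothesis hh : h = 2 * k - t%:Z.
Let s : int := 2 * h - 1.
Hypothesis hsqrtD : sqrtD ^+ 2 = s%:~R ^+ 2 + 4.
Let v : F := (sqrtD - s%:~R) / 2.

(** The generator (1 + sqrtD) / 2 equals v + h, an integral translate of v; its square is itself
    plus (D - 1) / 4 = h^2 - h + 1. *)
Lemma Zadjoin_conj_unit (x : F) :
  Zadjoin ((1 + sqrtD) / 2) x <-> exists p q : int, x = p%:~R + q%:~R * v.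
Proof.
have -> : Zadjoin ((1 + sqrtD) / 2) x <->
    exists p q : int, x = p%:~R + q%:~R * ((1 + sqrtD) / 2).
  apply: (@Zadjoin_quadratic _ _ _ (h ^+ 2 - h + 1) 1).
  rewrite expr_div_n sqrrD hsqrtD /s !(intrD, intrB, intrM).
  by field; rewrite !natr_eq0_fieldExt.
have e : (1 + sqrtD) / 2 = v + h%:~R.
  by rewrite /v /s !(intrD, intrB, intrM); field; rewrite !natr_eq0_fieldExt.
split=> -[p [q ->]]; [exists (p + q * h), q|exists (p - q * h), q];
  by rewrite !(intrD, intrB, intrM) e; ring.
Qed.

Lemma order_coordP (x : B) :
  generated_module (Zadjoin ((1 + sqrtD) / 2))
    [tuple e0; e1;
       ((sqrtD + 1) / 4) *: e0 + ((sqrtD + 3) / 4) *: e1 + 2^-1 *: e2;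
       ((sqrtD + 3) / 4) *: e0 + ((sqrtD + 1) / 4) *: e1 + 2^-1 *: e3] x <->
  exists d0 f0 d1 f1 p2 q2 p3 q3 : int,
    let A0 := 2 * d0 + q2 + q3 + p3 in
    let B0 := 2 * f0 + p2 - s * q2 + p3 + (1 - s) * q3 in
    let A1 := 2 * d1 + q2 + p2 + q3 in
    let B1 := 2 * f1 + p2 + (1 - s) * q2 + p3 - s * q3 in
    let X0 := (A0%:~R + B0%:~R * v) / 2 in
    let X1 := (A1%:~R + B1%:~R * v) / 2 in
    x = (if t then X1 else X0) *: e0 + (if t then X0 else X1) *: e1
      + ((p2%:~R + q2%:~R * v) / 2) *: e2 + ((p3%:~R + q3%:~R * v) / 2) *: e3.
Proof.
(* [v] reduces mod 2 to the class of [(1 + sqrtD) / 2] or to its conjugate,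
   according to the parity of [h]; conjugating swaps the first two components. *)
have hvv : v ^+ 2 = 1 - s%:~R * v.
  by rewrite /v expr_div_n sqrrB hsqrtD; field; rewrite !natr_eq0_fieldExt.
have eD : sqrtD = 2 * v + s%:~R by rewrite /v; field; rewrite !natr_eq0_fieldExt.
have h4 : (4 : F) != 0 by rewrite !natr_eq0_fieldExt.
have h2 : (2 : F) != 0 by rewrite !natr_eq0_fieldExt.
have hs : s = 4 * k - 2 * t%:Z - 1 by rewrite /s hh; ring.
have {}hvv : v * v = 1 - (4 * k - 2 * t%:Z - 1)%:~R * v by rewrite -hs -hvv expr2.
rewrite generated_module4; split.
  move=> [c0 [c1 [c2 [c3 [[]]]]]].
  move=> /Zadjoin_conj_unit[p0 [q0 ->]] /Zadjoin_conj_unit[p1 [q1 ->]].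
  move=> /Zadjoin_conj_unit[p2 [q2 ->]] /Zadjoin_conj_unit[p3 [q3 ->]] ->.
  (* The coefficients (sqrtD + 1) / 4 and (sqrtD + 3) / 4 are (v + h) / 2 and (v + h + 1) / 2; the
     even part 2 k of h is absorbed into the free integers. *)
  exists (if t then p1 + k * (p2 + p3) - p3 else p0 + k * (p2 + p3)),
    (if t then q1 + k * (q2 + q3) - q3 else q0 + k * (q2 + q3)),
    (if t then p0 + k * (p2 + p3) - p2 else p1 + k * (p2 + p3)),
    (if t then q0 + k * (q2 + q3) - q2 else q1 + k * (q2 + q3)), p2, q2, p3, q3.
  rewrite collect_coord /=; congr (_ *: _ + _ *: _ + _ *: _ + _ *: _); rewrite eD hs.
  - by move: hvv; case: (t) => /= hvv'; field: hvv'; rewrite h2 h4.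
  - by move: hvv; case: (t) => /= hvv'; field: hvv'; rewrite h2 h4.
move=> [d0 [f0 [d1 [f1 [p2 [q2 [p3 [q3 ->]]]]]]]].
exists (if t then (d1 - k * (p2 + p3) + p2)%:~R + (f1 - k * (q2 + q3) + q2)%:~R * v
        else (d0 - k * (p2 + p3))%:~R + (f0 - k * (q2 + q3))%:~R * v),
  (if t then (d0 - k * (p2 + p3) + p3)%:~R + (f0 - k * (q2 + q3) + q3)%:~R * v
   else (d1 - k * (p2 + p3))%:~R + (f1 - k * (q2 + q3))%:~R * v),
  (p2%:~R + q2%:~R * v), (p3%:~R + q3%:~R * v).
split; first by case: (t); split; apply/Zadjoin_conj_unit; do 2!eexists.
rewrite collect_coord /=; congr (_ *: _ + _ *: _ + _ *: _ + _ *: _); rewrite eD hs.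
- by move: hvv; case: (t) => /= hvv'; field: hvv'; rewrite h2 h4.
- by move: hvv; case: (t) => /= hvv'; field: hvv'; rewrite h2 h4.
Qed.
End OrderCoordinates.

(** * Entries of the embedded order, and the similarity with E8 *)

Lemma embedding_entry (R : realType) (F : fieldExtType rat) (B : falgType F)
    (sigma1 sigma2 : {rmorphism F -> R}) (i j k : B) (alpha : F)
    (c : seq F) (l : nat) :
  basis_of fullv [tuple 1; i; j; k] -> (l < 4)%N ->
  let u := quaternion_embedding sigma1 sigma2 i j k alpha
    (c`_0 *: 1 + c`_1 *: i + c`_2 *: j + c`_3 *: k) in
  u 0 (inord l.*2) = Num.sqrt (2 * sigma1 alpha) * sigma1 c`_l /\
  u 0 (inord l.*2.+1) = Num.sqrt (2 * sigma2 alpha) * sigma2 c`_l.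
Proof.
move=> hb hl u.
have hc : coord [tuple 1; i; j; k] (inord l)
    (c`_0 *: 1 + c`_1 *: i + c`_2 *: j + c`_3 *: k) = c`_l.
  have := coord_sum_free (fun m : 'I_4 => c`_m) (inord l) (basis_free hb).
  by rewrite !big_ord_recr big_ord0 /= add0r inordK.
have hl2 : (l.*2.+1 < 8)%N by rewrite (@ltn_Sdouble _ 4).
by rewrite /u !mxE !inordK // 1?ltnW //= !odd_double doubleK uphalf_double hc.
Qed.

Theorem theorem4 (R : realType) (D : nat) (s : int)
  (hD0 : (0 < D)%N) (hD4 : D = 1 %[mod 4]) (hDsf : square_free D)
  (hDs : D%:Z = s ^+ 2 + 4)
  (F : fieldExtType rat) (sqrtD : F)
  (hsqrtD : sqrtD ^+ 2 = D%:R) (hF : <<1; sqrtD>>%VS = {:F}%VS)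
  (sigma1 sigma2 : {rmorphism F -> R}) (hsigma : sigma1 <> sigma2 :> (F -> R))
  (B : falgType F) (i j k : B)
  (hB : quaternion_basis (-1) (-1) i j k) :
  let ZF := Zadjoin ((1 + sqrtD) / 2) in
  let O := generated_module ZF
    [tuple 1;
           i;
           ((sqrtD + 1) / 4)%:A + ((sqrtD + 3) / 4) *: i + 2^-1 *: j;
           ((sqrtD + 3) / 4)%:A + ((sqrtD + 1) / 4) *: i + 2^-1 *: k] in
  let eps := (s%:~R + sqrtD) / 2 in
  let alpha := eps / sqrtD in
  similar_lattices (quaternion_lattice sigma1 sigma2 i j k O alpha) (@E8 R).
Proof.
move=> ZF O eps alpha.
have [h hs] := odd_of_sqrD4 hD4 hDs.
(* Here [t] records s mod 4: s is 1 mod 4 when [t] holds, and 3 otherwise. *)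
have [k' [t hh]] : exists (k' : int) (t : bool), h = 2 * k' - t%:Z.
  have [k' [e|e]] := int_parity h; [exists k', false|exists (k' + 1), true];
  rewrite e /=; ring.
have hD' : sqrtD ^+ 2 = s%:~R ^+ 2 + 4.
  by rewrite hsqrtD -[D%:R]/((D%:Z)%:~R) hDs rmorphD rmorphXn.
have sqrtD0 : sqrtD != 0 by rewrite -sqrf_eq0 hsqrtD natr_eq0_fieldExt -lt0n.
pose v : F := (sqrtD - s%:~R) / 2.
(* Indeed 1 + v^2 = sqrtD v and eps v = (D - s^2) / 4 = 1. *)
have halpha : alpha * (1 + v ^+ 2) = 1.
  by rewrite /alpha /eps /v; field: hD'; rewrite sqrtD0 !natr_eq0_fieldExt.
have hw (sigma : {rmorphism F -> R}) :
    2 * (Num.sqrt (2 * sigma alpha) / 2) ^+ 2 * (1 + sigma v ^+ 2) = 1.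
  have h1 : sigma alpha * (1 + sigma v ^+ 2) = 1.
    by have := congr1 sigma halpha; rewrite rmorphM rmorphD rmorphXn !rmorph1.
  (* [Num.sqrt] is 0 on negative numbers, so positivity matters; alpha is the inverse of 1 + v^2. *)
  have h2 : 0 <= 2 * sigma alpha.
    rewrite mulr_ge0 // -(pmulr_lge0 _ (_ : 0 < 1 + sigma v ^+ 2)) ?h1 //.
    by rewrite (lt_le_trans ltr01) // lerDl sqr_ge0.
  by rewrite expr_div_n sqr_sqrtr // -[RHS]h1; field.
have hsig2 : sigma2 sqrtD = - sigma1 sqrtD.
  have /eqP : sigma2 sqrtD ^+ 2 = sigma1 sqrtD ^+ 2.
    by rewrite -!rmorphXn /= hsqrtD !rmorph_nat.
  rewrite eqf_sqr => /orP[] /eqP // e; case: hsigma.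
  by apply/funext; apply: (rmorph_Fadjoin_inj hF).
(* The norm of v is (s^2 - D) / 4. *)
have hv12 : sigma1 v * sigma2 v = -1.
  have h1 : sigma1 sqrtD ^+ 2 = s%:~R ^+ 2 + 4.
    by rewrite -rmorphXn hD' rmorphD rmorphXn /= rmorph_int rmorph_nat.
  rewrite /v !fmorph_div !rmorphB /= !rmorph_int !rmorph_nat hsig2.
  by field: h1.
pose m := Num.sqrt (2 * sigma1 alpha) / 2.
pose n := Num.sqrt (2 * sigma2 alpha) / 2.
pose f := block_map m n (sigma1 v) (sigma2 v) t.
have [hb _ _ _ _] := hB.
(* The exchange of the components at 1 and i is undone by the one built into [block_map]. *)
have f_lattice (A0 B0 A1 B1 A2 B2 A3 B3 : int) :
  let X0 := (A0%:~R + B0%:~R * v) / 2 in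
  let X1 := (A1%:~R + B1%:~R * v) / 2 in
  f (quaternion_embedding sigma1 sigma2 i j k alpha
     ((if t then X1 else X0) *: 1 + (if t then X0 else X1) *: i +
      ((A2%:~R + B2%:~R * v) / 2) *: j + ((A3%:~R + B3%:~R * v) / 2) *: k)) =
  row8 [seq z%:~R / 2 | z <- [:: A2 + A3; A2 - A3; A1 + A0; A1 - A0;
                                 B0 + B2; B0 - B2; B1 + B3; B1 - B3]].
  move=> X0 X1.
  set u := quaternion_embedding _ _ _ _ _ _ _.
  pose As := [:: if t then A1 else A0; if t then A0 else A1; A2; A3].
  pose Bs := [:: if t then B1 else B0; if t then B0 else B1; B2; B3].
  have hu l : (l < 4)%N ->
      pair_fst m n u l = (As`_l)%:~R / 2 /\
      pair_snd m n (sigma1 v) (sigma2 v) u l = (Bs`_l)%:~R / 2.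
    move=> hl; pose c := mkseq (fun l => ((As`_l)%:~R + (Bs`_l)%:~R * v) / 2) 4.
    have [e1 e2] := embedding_entry sigma1 sigma2 alpha c hb hl.
    have hu : u = quaternion_embedding sigma1 sigma2 i j k alpha
        (c`_0 *: 1 + c`_1 *: i + c`_2 *: j + c`_3 *: k).
      by rewrite /u /X0 /X1 /c /As /Bs /=; case: (t).
    have hc (sigma : {rmorphism F -> R}) :
        sigma c`_l = ((As`_l)%:~R + (Bs`_l)%:~R * sigma v) / 2.
      rewrite nth_mkseq // fmorph_div rmorphD rmorphM /= !rmorph_int.
      by rewrite rmorph_nat.
    by apply: pair_coord; rewrite ?hv12 // ?hw // hu ?e1 ?e2 hc /m /n; field.
  have [f2 s2] := hu 2%N isT; have [f3 s3] := hu 3%N isT.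
  have [f0 s0] := hu 0%N isT; have [f1 s1] := hu 1%N isT.
  rewrite /f /block_map f2 s2 f3 s3; congr row8.
  move: f0 s0 f1 s1; rewrite /As /Bs /=.
  by case: (t) => /= -> -> -> ->; rewrite !(intrD, intrN) !mulrDl !mulNr.
(* The scaling factor is 1. [order_coordP] and [E8P] use the same eight integer parameters, which
   [f_lattice] matches in both inclusions. *)
exists f, 1; split=> //; first by apply: block_map_isometry => //; apply: hw.
rewrite seteqP; split=> z.
  rewrite (E8P h) => -[d0 [f0 [d1 [f1 [p2 [q2 [p3 [q3 ->]]]]]]]].
  eexists; last by rewrite scale1r -f_lattice.
  eexists=> //; apply/(order_coordP _ _ _ _ hh).
    by rewrite -hs.
  by exists d0, f0, d1, f1, p2, q2, p3, q3; rewrite /v hs.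
move=> [_ [x hx <-] <-]; rewrite scale1r.
move: hx; rewrite /O /ZF (order_coordP _ _ _ _ hh); last by rewrite -hs.
move=> [d0 [f0 [d1 [f1 [p2 [q2 [p3 [q3 ->]]]]]]]].
apply/(E8P h); exists d0, f0, d1, f1, p2, q2, p3, q3.
by rewrite -hs; apply: f_lattice.
Qed.
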